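(* Let $n\ge1$, let $\Sigma''\subset\{1,\dots,n\}^2$ be a prescribed index set, let $\sigma$ be a permutation of $\{1,2,\dots,n\}$, and let $\Sigma':=\{(i,\sigma(i)): i=1,\dots,n\}$. Then the union $$\Sigma:=\Sigma'\cup\Sigma''\cup\Sigma''',\qquad \Sigma''':=\{(\sigma^{-1}(j),\sigma(i)):(i,j)\in\Sigma''\},$$ has total support.
   Context: For a permutation $\tau$ of $\{1,\dots,n\}$, the sequence $X_{1,\tau(1)},\dots,X_{n,\tau(n)}$ is called a diagonal of the $n\times n$ matrix $X$ (corresponding to $\tau$). A nonnegative square matrix $X$ has total support if $X\neq0$ and every positive entry of $X$ lies on a diagonal of $X$ all of whose entries are positive. An index set $\Sigma\subset\{1,\dots,n\}^2$ has total support if its indicator matrix (entry $1$ at each $(i,j)\in\Sigma$, entry $0$ elsewhere) has total support. *)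

(* Defs.v *)
From mathcomp Require Import all_boot all_order all_fingroup all_algebra.

Set Implicit Arguments.
Unset Strict Implicit.
Unset Printing Implicit Defensive.

Import Order.TTheory GRing.Theory Num.Theory.

Local Open Scope ring_scope.

Definition nonneg_mx (R : realFieldType) (n : nat) (X : 'M[R]_n) : Prop :=
  forall i j, 0 <= X i j.

Definition diagonal (R : realFieldType) (n : nat) (X : 'M[R]_n) (tau : 'S_n) :
    'I_n -> R :=
  fun k => X k (tau k).

(* The entry at position (i, j) lies on the diagonal of tau when tau i = j:
   membership concerns the position, not merely the value of the entry. *)
Definition total_support (R : realFieldType) (n : nat) (X : 'M[R]_n) : Prop :=
  [/\ nonneg_mx X,
      X != 0
    & forall i j, 0 < X i j ->
        exists2 tau : 'S_n, tau i = j & forall k, 0 < diagonal X tau k].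

Definition indicator_mx (R : realFieldType) (n : nat)
    (Sigma : {set 'I_n * 'I_n}) : 'M[R]_n :=
  \matrix_(i, j) (if (i, j) \in Sigma then 1 else 0).

Definition set_total_support (R : realFieldType) (n : nat)
    (Sigma : {set 'I_n * 'I_n}) : Prop :=
  total_support (indicator_mx R Sigma).

(* Main.v *)
(** A position (i, j) of Sigma2 and its partner (sigma^-1 j, sigma i) in Sigma3
    lie on the diagonal of the permutation obtained from sigma by exchanging
    its values at i and sigma^-1 j; every other position of that diagonal
    is on the diagonal of sigma. *)

Require Import Defs.
From mathcomp Require Import all_boot all_order all_fingroup all_algebra.

Import Order.TTheory GRing.Theory Num.Theory.

Lemma indicator_mx_gt0 (R : realFieldType) (n : nat)
    (Sigma : {set 'I_n * 'I_n}) (i j : 'I_n) :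
  (0 < indicator_mx R Sigma i j)%R = ((i, j) \in Sigma).
Proof. by rewrite mxE; case: ifP => _; rewrite ?ltr01 ?ltxx. Qed.

(** Positivity of an indicator entry is membership, so the ordered field drops out: what remains is
    to cover [Sigma] by graphs of permutations lying inside it. *)
Lemma set_total_supportP (R : realFieldType) (n : nat)
    (Sigma : {set 'I_n * 'I_n}) :
  Sigma != set0 ->
  (forall i j, (i, j) \in Sigma ->
     exists2 tau : 'S_n, tau i = j & forall k, (k, tau k) \in Sigma) ->
  set_total_support R Sigma.
Proof.
move=> /set0Pn[[i0 j0] S0] diagS; split.
- by move=> i j; rewrite mxE; case: ifP => _; rewrite ?ler01.
- apply/eqP => X0; move: S0.
  by rewrite -(indicator_mx_gt0 R) X0 mxE ltxx.
- move=> i j; rewrite indicator_mx_gt0 => /diagS[tau tau_i tauS].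
  by exists tau => // k; rewrite /diagonal indicator_mx_gt0.
Qed.

Theorem proposition2p3 (R : realFieldType) (n : nat) (hn : (1 <= n)%N)
    (Sigma2 : {set 'I_n * 'I_n}) (sigma : 'S_n) :
  let Sigma1 : {set 'I_n * 'I_n} := [set (i, sigma i) | i : 'I_n] in
  let Sigma3 : {set 'I_n * 'I_n} :=
    [set ((sigma^-1)%g p.2, sigma p.1) | p in Sigma2] in
  set_total_support R (Sigma1 :|: Sigma2 :|: Sigma3).
Proof.
move=> Sigma1 Sigma3; set Sigma := _ :|: Sigma3.
have S1 k : (k, sigma k) \in Sigma by rewrite !inE imset_f.
have S2 i j : (i, j) \in Sigma2 -> (i, j) \in Sigma.
  by move=> ij; rewrite !inE ij orbT.
have S3 i j : (i, j) \in Sigma2 -> ((sigma^-1)%g j, sigma i) \in Sigma.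
  move=> ij; rewrite inE; apply/orP; right.
  by apply/imsetP; exists (i, j).
(* The left factor acts first, so the swap is applied to the index before [sigma]. If [sigma i = j],
   the swap is trivial and [tau i j] is [sigma]. *)
pose tau i j := (tperm i ((sigma^-1)%g j) * sigma)%g.
have tauS i j : (i, j) \in Sigma2 -> forall k, (k, tau i j k) \in Sigma.
  move=> ij k; rewrite permM; case: tpermP => [->|->|_ _].
  - by rewrite permKV; apply: S2.
  - exact: S3.
  - exact: S1.
apply: set_total_supportP => [|a b].
  (* [hn] provides the index 0, hence a position on the diagonal of [sigma]. *)
  by apply/set0Pn; exists (Ordinal hn, sigma (Ordinal hn)).
rewrite !inE => /orP[/orP[/imsetP[i _ [-> ->]]|ab]|/imsetP[[i j] ij [-> ->]]].
- by exists sigma.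
- by exists (tau a b); [rewrite permM tpermL permKV | apply: tauS].
(* A partner position reuses the permutation built from its source [(i, j)], read at the other
   swapped index. *)
- by exists (tau i j); [rewrite permM tpermR | apply: tauS].
Qed.
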